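(* There is a split graph $G$ such that $|V(\mathcal{H}(G))|\ge 2^{n/6}+2n/3-2$, where $n=|V(G)|$.
   Context: A split graph is a graph whose vertex set can be partitioned into a clique and an independent set. A graph is Helly if every family of pairwise intersecting disks $D(v,r)=\{u:d(u,v)\le r\}$ (shortest-path metric) has a common vertex. The injective hull $\mathcal{H}(G)$ of a connected graph $G$ is the unique minimal Helly graph containing $G$ as an isometric subgraph (equivalently, the graph on functions $f:V(G)\to\mathbb{Z}_{\ge0}$ with $f(x)+f(y)\ge d_G(x,y)$ for all $x,y$ and for each $x$ some $y$ with equality, adjacency meaning sup-norm distance 1). *)

(* Defs.v *)
From HB Require Import structures.
From mathcomp Require Import all_boot all_order all_algebra.

Set Implicit Arguments.
Unset Strict Implicit.
Unset Printing Implicit Defensive.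

Record sgraph := SGraph {
  vertex :> finType;
  adj : rel vertex;
  adj_sym : symmetric adj;
  adj_irr : irreflexive adj }.

Definition connected_graph (G : sgraph) : Prop :=
  forall x y : G, connect (@adj G) x y.

Definition clique (G : sgraph) (K : {set G}) : Prop :=
  {in K &, forall x y, x != y -> adj x y}.

Definition independent (G : sgraph) (S : {set G}) : Prop :=
  {in S &, forall x y, ~~ adj x y}.

Definition split_graph (G : sgraph) : Prop :=
  exists K : {set G}, clique K /\ independent (~: K).

Definition walk (G : sgraph) (x y : G) (k : nat) : bool :=
  [exists p : k.-tuple G, path (@adj G) x p && (last x p == y)].

(* Length of a shortest walk; it takes the junk value #|G| when y is not
   reachable from x, which does not occur in a connected graph. *)
Definition gdist (G : sgraph) (x y : G) : nat :=
  find (walk x y) (iota 0 #|G|).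

Lemma gdist_le (G : sgraph) (x y : G) : gdist x y <= #|G|.
Proof. by rewrite /gdist (leq_trans (find_size _ _)) ?size_iota. Qed.

Lemma gdist_min (G : sgraph) (x y : G) k : walk x y k -> gdist x y <= k.
Proof.
move=> wk; rewrite leqNgt; apply/negP => lt_k.
have := before_find 0 lt_k; rewrite nth_iota ?add0n ?wk //.
exact: leq_trans lt_k (gdist_le x y).
Qed.

Lemma gdist_walk (G : sgraph) (x y : G) :
  connect (@adj G) x y -> walk x y (gdist x y).
Proof.
case/connectP=> p0 /shortenP[p pp Up _] ->.
have ltp : size p < #|G|.
  by rewrite -[(size p).+1]/(size (x :: p)) -(card_uniqP Up) max_card.
have wp : walk x (last x p) (size p).
  by apply/existsP; exists (in_tuple p); rewrite pp eqxx.
have hw : has (walk x (last x p)) (iota 0 #|G|).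
  by apply/hasP; exists (size p); rewrite ?mem_iota.
have := nth_find 0 hw; rewrite nth_iota ?add0n //.
by rewrite -[X in _ < X](size_iota 0 #|G|) -has_find.
Qed.

Definition extremal (G : sgraph) (f : G -> nat) : bool :=
  [forall x, forall y, gdist x y <= f x + f y] &&
  [forall x, exists y, f x + f y == gdist x y].

(* Restricting to values at most #|G| loses no extremal function (see
   hull_vertexP) and makes the vertex set of the hull a finite type. *)
Definition hull_vertex (G : sgraph) : finType :=
  {f : {ffun G -> 'I_#|G|.+1} | extremal (fun x => f x : nat)}.

Definition hull_fun (G : sgraph) (u : hull_vertex G) (x : G) : nat :=
  sval u x.

Lemma hull_vertexP (G : sgraph) (f : G -> nat) :
  extremal f <-> exists u : hull_vertex G, hull_fun u =1 f.
Proof.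
have ext_eq (g h : G -> nat) : g =1 h -> extremal g = extremal h.
  move=> gh; rewrite /extremal; congr (_ && _).
    by apply: eq_forallb => x; apply: eq_forallb => y; rewrite !gh.
  by apply: eq_forallb => x; apply: eq_existsb => y; rewrite !gh.
split=> [ef|[u uf]]; last by rewrite -(ext_eq _ _ uf); exact: (svalP u).
have le_f x : f x < #|G|.+1.
  case/andP: ef => _ /forallP/(_ x)/existsP[y /eqP fxy].
  by rewrite ltnS (leq_trans (leq_addr (f y) _)) // fxy gdist_le.
pose g := [ffun x => Ordinal (le_f x)].
have gf : (fun x => g x : nat) =1 f by move=> x; rewrite ffunE.
have eg : extremal (fun x => g x : nat) by rewrite (ext_eq _ _ gf).
by exists (exist _ g eg).
Qed.

Lemma hull_fun_inj (G : sgraph) (u v : hull_vertex G) :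
  hull_fun u =1 hull_fun v -> u = v.
Proof. by move=> uv; apply/val_inj/ffunP => x; apply/val_inj/uv. Qed.

Definition sup_dist (G : sgraph) (u v : hull_vertex G) : nat :=
  \max_(x : G) `|hull_fun u x - hull_fun v x|%N.

Definition hull_adj (G : sgraph) : rel (hull_vertex G) :=
  fun u v => sup_dist u v == 1.

Lemma hull_adj_sym (G : sgraph) : symmetric (@hull_adj G).
Proof.
move=> u v; rewrite /hull_adj /sup_dist.
by congr (_ == _); apply: eq_bigr => x _; rewrite distnC.
Qed.

Lemma hull_adj_irr (G : sgraph) : irreflexive (@hull_adj G).
Proof.
move=> u; rewrite /hull_adj /sup_dist big1 // => x _.
by rewrite distnn.
Qed.

(* Integral form of Isbell's tight span: for connected G this is the minimal
   Helly graph containing G isometrically, via x |-> gdist x. *)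
Definition injective_hull (G : sgraph) : sgraph :=
  SGraph (@hull_adj_sym G) (@hull_adj_irr G).

(* Main.v *)
(* The independent set consists of p antipodal pairs {(i, true), (i, false)},
   and the neighbourhoods of the 2p clique vertices are transversals of these
   pairs that cover every non-antipodal pair of independent vertices: antipodal
   vertices are at distance 3, all other vertices at distance at most 2.  For
   each choice of one vertex in every pair, the function equal to 1 on the
   chosen vertices and to 2 elsewhere dominates the distance, hence lies above
   an extremal function; as the two values on a pair must add up to at least 3,
   that function keeps the same values on all pairs.  The hull therefore has at
   least 2 ^ p vertices while G has only 4p. *)
Require Import Defs.
From HB Require Import structures.
From mathcomp Require Import all_boot all_order all_algebra.
From mathcomp Require Import zify lra.
From mathcomp Require Import reals exp.

Set Implicit Arguments.
Unset Strict Implicit.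
Unset Printing Implicit Defensive.

Import Order.TTheory GRing.Theory Num.Theory.
Local Open Scope ring_scope.

Lemma walkP (G : sgraph) (x y : G) (k : nat) :
  reflect (exists p : seq G, [/\ path (@adj G) x p, last x p = y & size p = k])
          (walk x y k).
Proof.
apply: (iffP existsP) => [[p /andP[pp /eqP pl]]|[p [pp pl /eqP sp]]].
  by exists p; rewrite size_tuple.
by exists (Tuple sp); rewrite /= pp pl eqxx.
Qed.

Lemma gdist_xx (G : sgraph) (x : G) : gdist x x = 0%N.
Proof. by apply/eqP; rewrite -leqn0; apply/gdist_min/walkP; exists [::]. Qed.

Lemma walkC (G : sgraph) (x y : G) (k : nat) : walk x y k = walk y x k.
Proof.
wlog suff walk_rev : x y / walk x y k -> walk y x k.
  by apply/idP/idP; exact: walk_rev.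
case/walkP=> p [pp pl ps]; apply/walkP; exists (rev (belast x p)).
rewrite -pl rev_path size_rev size_belast; split=> //.
  by rewrite (eq_path (e' := @adj G)) // => u v; exact: adj_sym.
by case: (p) => //= z q; rewrite rev_cons last_rcons.
Qed.

Lemma gdistC (G : sgraph) (x y : G) : gdist x y = gdist y x.
Proof. by apply: eq_find => k; exact: walkC. Qed.

(** Induction on the sum of the values: if no [y] is tight for [x], lowering [f] by one at [x] alone
    keeps every distance inequality. *)
Lemma extremal_below (G : sgraph) (f : G -> nat) :
  (forall x y, (gdist x y <= f x + f y)%N) ->
  exists g : G -> nat, extremal g /\ forall x, (g x <= f x)%N.
Proof.
have [m] := ubnP (\sum_x f x)%N; elim: m f => // m IHm f lefm fP.
have [ef|] := boolP (extremal f); first by exists f.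
rewrite negb_and => /orP[/forallPn[x /forallPn[y]]|]; first by rewrite fP.
case/forallPn=> x /existsPn slack.
have slackP y : (gdist x y < f x + f y)%N.
  by rewrite ltn_neqAle fP eq_sym slack.
have fx_gt0 : (0 < f x)%N by have := slackP x; lia.
have slackP' y : (gdist y x < f x + f y)%N by rewrite gdistC.
pose h y := if y == x then (f x).-1 else f y.
have le_hf y : (h y <= f y)%N by rewrite /h; case: eqP => // ->; lia.
have [||g [eg gh]] := IHm h.
- rewrite ltnS in lefm; apply: leq_trans lefm.
  rewrite (bigD1 x) //= [leqRHS](bigD1 x) //= {1}/h eqxx -addSn prednK //.
  by rewrite leq_add2l; apply: leq_sum => y _; exact: le_hf.
- move=> y z; rewrite /h; case: eqP => [->|_]; case: eqP => [->|_] //.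
  + by rewrite gdist_xx.
  + by have := slackP z; lia.
  + by have := slackP' y; lia.
by exists g; split=> // y; apply: leq_trans (le_hf y).
Qed.

Section CocktailSplit.

Variable m : nat.
(** At least three pairs, so that any two indices leave a third one free. *)
Let p := m.+3.
Let pt : finType := ('I_p * bool)%type.

(* Clique vertices are tagged inl; inl (j, b) is joined to inr (j, b) and to
   all inr (i, ~~ b) with i != j. *)
Definition meets (u v : pt) : bool := (u.1 == v.1) == (u.2 == v.2).

Definition cs_adj (x y : pt + pt) : bool :=
  match x, y with
  | inl u, inl v => u != v
  | inl u, inr v | inr v, inl u => meets u v
  | inr _, inr _ => false
  end.

Lemma cs_adj_sym : symmetric cs_adj.
Proof. by move=> [u|u] [v|v] //=; rewrite eq_sym. Qed.

Lemma cs_adj_irr : irreflexive cs_adj.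
Proof. by case=> u //=; rewrite eqxx. Qed.

Definition cs_graph : sgraph := SGraph cs_adj_sym cs_adj_irr.

Definition antipodal (x y : cs_graph) : bool :=
  match x, y with
  | inr u, inr v => (u.1 == v.1) && (u.2 != v.2)
  | _, _ => false
  end.

Lemma meets_refl (u : pt) : meets u u.
Proof. by rewrite /meets !eqxx. Qed.

Lemma ord_avoid2 (i j : 'I_p) : exists l : 'I_p, (l != i) && (l != j).
Proof.
apply/existsP; apply: contraT => /existsPn avoid.
have := subset_leq_card (A := [set: 'I_p]) (B := [set i; j]).
rewrite cardsT card_ord cards2 => /(_ _)/negPn; rewrite -ltnNge.
have /[swap] /[apply] : [set: 'I_p] \subset [set i; j].
  apply/subsetP=> l _; rewrite !inE; have := avoid l.
  by rewrite negb_and !negbK.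
by move/negP; case; case: (i != j).
Qed.

Lemma common_neighbour (u v : pt) :
  ~~ ((u.1 == v.1) && (u.2 != v.2)) -> exists w, meets w u && meets w v.
Proof.
case: u v => [i b] [j c] /=; rewrite /meets /=.
have [<- /=|ij _] := eqVneq i j.
  by rewrite negbK => /eqP <-; exists (i, b); rewrite !eqxx.
have [<-|bc] := eqVneq b c; last by exists (i, b); rewrite /= !eqxx (negPf ij) (negPf bc).
(* Equal signs on distinct pairs: a clique vertex of the opposite sign over a third index meets
   both. *)
have [l /andP[li lj]] := ord_avoid2 i j.
by exists (l, ~~ b); rewrite /= (negPf li) (negPf lj); case: (b).
Qed.

(** An explicit path serves twice: for connectedness and for the upper bound on distances. *)
Lemma cs_short_path (x y : cs_graph) : exists q : seq cs_graph,
  [/\ path (@adj cs_graph) x q, last x q = y & (size q <= 2 + antipodal x y)%N].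
Proof.
have [<-|xy] := eqVneq x y; first by exists [::].
case: x y xy => [u|u] [v|v] xy.
- by exists [:: inl v]; rewrite /= andbT.
- have [->|uv] := eqVneq u v; first by exists [:: inr v]; rewrite /= meets_refl.
  by exists [:: inl v; inr v]; rewrite /= uv meets_refl.
- have [->|uv] := eqVneq u v; first by exists [:: inl v]; rewrite /= meets_refl.
  by exists [:: inl u; inl v]; rewrite /= uv meets_refl.
have [uv|/common_neighbour[w /andP[wu wv]]] := boolP (antipodal (inr u) (inr v)).
  have uv' : u != v by apply: contraNneq xy => ->.
  by exists [:: inl u; inl v; inr v]; rewrite /= !meets_refl uv'.
by exists [:: inl w; inr v]; rewrite /= wu wv.
Qed.

Lemma cs_connected : connected_graph cs_graph.
Proof.
by move=> x y; have [q [pq <- _]] := cs_short_path x y; apply/connectP; exists q.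
Qed.

Lemma cs_split : split_graph cs_graph.
Proof.
exists [set x : cs_graph | if x is inl _ then true else false]; split.
  by move=> [u|u] [v|v]; rewrite !inE.
by move=> [u|u] [v|v]; rewrite !inE.
Qed.

Lemma card_cs : #|cs_graph| = (4 * p)%N.
Proof. by rewrite card_sum !card_prod card_ord card_bool; lia. Qed.

Lemma cs_gdist_le (x y : cs_graph) : (gdist x y <= 2 + antipodal x y)%N.
Proof.
have [q [pq lq sq]] := cs_short_path x y.
by apply: leq_trans sq; apply/gdist_min/walkP; exists q.
Qed.

(** The middle of a walk of length 2 would be a clique vertex, but each of these is adjacent to
    exactly one member of every pair. *)
Lemma cs_gdist_antipodal (i : 'I_p) (b : bool) :
  (3 <= gdist (inr (i, b) : cs_graph) (inr (i, ~~ b)))%N.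
Proof.
have := gdist_walk (cs_connected (inr (i, b)) (inr (i, ~~ b))).
case: gdist => [|[|[|//]]] /walkP[q []].
- by case: q => //= _ []; case: b.
- by case: q => [|x []] //= /andP[+ _] ex; rewrite ex.
case: q => [|x [|y []]] //= /and3P[+ + _] ey _; rewrite {}ey.
by case: x => [[j c]|//]; rewrite /= /meets /= => /eqP ->; case: b c => [] [].
Qed.

Lemma card_cs_hull : (2 ^ p <= #|injective_hull cs_graph|)%N.
Proof.
(* Reads the choice in each pair back from a hull vertex; surjectivity of [sel] gives the count. *)
pose sel (u : hull_vertex cs_graph) : {ffun 'I_p -> bool} :=
  [ffun i => hull_fun u (inr (i, true)) == 1%N].
have sel_onto e : e \in codom sel.
  pose f (x : cs_graph) := if x is inr v then (e v.1 != v.2).+1 else 2%N.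
  have [|g [eg gf]] := @extremal_below cs_graph f.
    move=> x y; apply: leq_trans (cs_gdist_le x y) _.
    case: x y => [u|[i b]] [v|[j c]] //=; rewrite ?addn0; try lia.
    (* Antipodal vertices are never both chosen, so their values under [f] sum to exactly 3. *)
    by have [<-|] := eqVneq i j => /=; try lia; case: (e i) b c => [] [] [].
  have gT i : g (inr (i, true)) = (~~ e i).+1.
    case/andP: eg => /forallP/(_ (inr (i, true)))/forallP/(_ (inr (i, false))).
    have := cs_gdist_antipodal i true; have := gf (inr (i, true)).
    by have := gf (inr (i, false)); rewrite /f /=; case: (e i) => /=; lia.
  have [u ug] := (hull_vertexP g).1 eg.
  apply/codomP; exists u; apply/ffunP => i; rewrite ffunE ug gT.
  by case: (e i).
rewrite -{1}[p]card_ord -{1}card_bool -card_ffun.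
apply: leq_trans (leq_image_card sel _).
by apply/subset_leq_card/subsetP => e _; exact: sel_onto.
Qed.

End CocktailSplit.

Theorem theorem6 (R : realType) (N : nat) :
  exists G : sgraph,
    [/\ connected_graph G,
        split_graph G,
        (N <= #|G|)%N
      & (2 : R) `^ (#|G|%:R / 6) + 2 * #|G|%:R / 3 - 2
          <= #|injective_hull G|%:R].
Proof.
(* With k = N + 2 this gives p = 3k and n = 12k, so that n/6 = 2k and 2n/3 = 8k are integers. *)
pose m := (3 * N + 3)%N; exists (cs_graph m).
have cardG : #|cs_graph m| = (12 * N.+2)%N by rewrite card_cs /m; lia.
split; first exact: cs_connected; first exact: cs_split.
  by rewrite cardG; lia.
have -> : #|cs_graph m|%:R / 6 = (2 * N.+2)%N%:R :> R.
  by rewrite cardG !natrM; lra.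
have -> : 2 * #|cs_graph m|%:R / 3 = (8 * N.+2)%N%:R :> R.
  by rewrite cardG !natrM; lra.
rewrite powR_mulrn ?ler0n // -natrX lerBlDr -!natrD ler_nat.
apply: leq_trans (leq_add (card_cs_hull m) (leqnn 2)).
have -> : m.+3 = (3 * N.+2)%N by rewrite /m; lia.
(* What remains is 4^k + 8k <= 8^k + 2, by induction from k = 2; it fails at k = 1. *)
rewrite !expnM; elim: (N) => // k IHk.
rewrite (expnS _ k.+2) [in leqRHS]expnS; lia.
Qed.
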